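(* Let $\mathbb{P}$ be a $\sigma$-centered forcing notion such that above every element of $\mathbb{P}$ there are two incompatible elements, and suppose $\mathbb{P}$ does not add a Cohen real. Then there exists a non-principal nowhere dense ultrafilter on $\omega$.
   Context: Forcing order convention: $p\leqslant q$ means $q$ is stronger (extends) $p$; ''above $p$'' means $\geqslant p$. $\mathbb{P}$ is $\sigma$-centered if $\mathbb{P}=\bigcup_{n<\omega}A_n$ where each $A_n$ is directed: for all $p,q\in A_n$ there is $r\in A_n$ with $p\leqslant r$ and $q\leqslant r$. $\mathbb{P}$ adds a Cohen real if there is a $\mathbb{P}$-name $\underline{r}$ for an element of ${}^\omega 2$ such that for every open dense set $\mathcal{D}\subseteq{}^\omega 2$ in the ground model, $\Vdash_{\mathbb{P}}\underline{r}\in\mathcal{D}^*$, where $\mathcal{D}^*$ is the reinterpretation (the open set coded by the same code) of $\mathcal{D}$ in the extension. A filter $D$ on $\omega$ is nowhere dense if for every function $f\colon\omega\to{}^\omega 2$ there is $A\in D$ such that $f(A)$ is nowhere dense in ${}^\omega 2$. *)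

(* Defs.v *)
From Stdlib Require Import List.
Import ListNotations.

Definition real := nat -> bool.

Definition prefix (s : list bool) (x : real) : Prop :=
  forall i, i < length s -> x i = nth i s false.

Definition basic (s : list bool) : real -> Prop := fun x => prefix s x.

Definition is_open (D : real -> Prop) : Prop :=
  forall x, D x -> exists n, forall y, (forall i, i < n -> y i = x i) -> D y.

Definition is_dense (D : real -> Prop) : Prop :=
  forall s, exists x, basic s x /\ D x.

Definition nowhere_dense (Y : real -> Prop) : Prop :=
  forall s, exists t, (forall i, i < length s -> nth i t false = nth i s false)
                      /\ length s <= length t
                      /\ forall x, basic t x -> ~ Y x.

(* A forcing notion: a type with a preorder; le p q means q extends p. *)
Record forcing := {
  cond :> Type;
  le : cond -> cond -> Prop;
  le_refl : forall p, le p p;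
  le_trans : forall p q r, le p q -> le q r -> le p r
}.

Definition compatible (P : forcing) (p q : P) : Prop :=
  exists r, le P p r /\ le P q r.

Definition splitting (P : forcing) : Prop :=
  forall p : P, exists q1 q2, le P p q1 /\ le P p q2 /\ ~ compatible P q1 q2.

Definition directed (P : forcing) (A : P -> Prop) : Prop :=
  forall p q, A p -> A q -> exists r, A r /\ le P p r /\ le P q r.

Definition sigma_centered (P : forcing) : Prop :=
  exists A : nat -> P -> Prop,
    (forall p, exists n, A n p) /\ (forall n, directed P (A n)).

(* A P-name for an element of 2^omega, represented (up to forced equality)
   by its forcing relation  forces p n b  <->  p ||- name(n) = b .
   The axioms are exactly those satisfied by the forcing relation of a name:
   monotone under extension, no condition forces two values, every n is
   decided densely, and closure: if densely many conditions below p force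
   name(n)=b then so does p. *)
Record real_name (P : forcing) := {
  forces : P -> nat -> bool -> Prop;
  forces_mono : forall p q n b, le P p q -> forces p n b -> forces q n b;
  forces_cons : forall p n, ~ (forces p n true /\ forces p n false);
  forces_dense : forall p n, exists q b, le P p q /\ forces q n b;
  forces_closed : forall p n b,
      (forall q, le P p q -> exists r, le P q r /\ forces r n b) -> forces p n b
}.

Definition forces_prefix (P : forcing) (r : real_name P) (q : P) (s : list bool) : Prop :=
  forall i, i < length s -> forces P r q i (nth i s false).

(* ||- name \in D^*, where D^* is the reinterpretation of the open set D,
   i.e. the union of the basic sets [s] with [s] subset of D (the code of D). *)
Definition forces_in_reinterp (P : forcing) (r : real_name P) (D : real -> Prop) : Prop :=
  forall p : P, exists q s, le P p q /\ (forall x, basic s x -> D x)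
                          /\ forces_prefix P r q s.

Definition adds_cohen_real (P : forcing) : Prop :=
  exists r : real_name P,
    forall D : real -> Prop, is_open D -> is_dense D -> forces_in_reinterp P r D.

Definition ultrafilter (U : (nat -> Prop) -> Prop) : Prop :=
  U (fun _ => True) /\
  ~ U (fun _ => False) /\
  (forall A B : nat -> Prop, U A -> (forall n, A n -> B n) -> U B) /\
  (forall A B : nat -> Prop, U A -> U B -> U (fun n => A n /\ B n)) /\
  (forall A : nat -> Prop, U A \/ U (fun n => ~ A n)).

Definition principal (U : (nat -> Prop) -> Prop) : Prop :=
  exists k, forall A : nat -> Prop, U A <-> A k.

Definition image (f : nat -> real) (A : nat -> Prop) : real -> Prop :=
  fun x => exists n, A n /\ f n = x.

Definition nowhere_dense_filter (U : (nat -> Prop) -> Prop) : Prop :=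
  forall f : nat -> real, exists A, U A /\ nowhere_dense (image f A).

(* Main.v *)
(** Suppose that no non-principal ultrafilter is nowhere dense, and let [A n] be the
    directed pieces of the forcing. Build a tree of open sets of conditions, each node
    split into countably many disjoint open pieces with dense union, so that level [n]
    takes care of [A n]: at some node, every [p] in [A n] meets infinitely many children,
    and the sets of children met by the members of [A n] generate a free filter on the
    indices. By fusion, the countably many filters arising at a node [v] share one sequence
    [f v] of reals taking somewhere dense values on each of their members. Label the [k]-th
    child of [v] by the label of [v] followed by the first [k + 1] bits of [f v k]; the
    union of the labels along the generic branch is then a Cohen real. *)

Require Import Defs.
From Stdlib Require Import List Arith Lia ClassicalChoice ClassicalEpsilon.
From mathcomp Require classical_sets filter.

(** * Somewhere dense sequences of reals *)

Definition dense_on (f : nat -> real) (A : nat -> Prop) (s : list bool) : Prop :=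
  forall u, exists k, A k /\ prefix (s ++ u) (f k).

Definition somewhere_dense (f : nat -> real) (A : nat -> Prop) : Prop :=
  exists s, dense_on f A s.

Lemma prefix_app_l (s u : list bool) (x : real) :
  prefix (s ++ u) x -> prefix s x.
Proof.
  intros H i Hi. rewrite (H i) by (rewrite length_app; lia).
  now rewrite app_nth1.
Qed.

Lemma prefix_app (s u : list bool) (x : real) :
  prefix s x -> prefix u (fun i => x (length s + i)) -> prefix (s ++ u) x.
Proof.
  intros Hs Hu i Hi. rewrite length_app in Hi.
  destruct (lt_dec i (length s)) as [h|h].
  - rewrite app_nth1 by lia. now apply Hs.
  - rewrite app_nth2 by lia.
    rewrite <- (Hu (i - length s)) by lia. f_equal. lia.
Qed.

Lemma prefix_map_seq (x : real) (n : nat) : prefix (map x (seq 0 n)) x.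
Proof.
  intros i Hi. rewrite length_map, length_seq in Hi.
  rewrite nth_indep with (d' := x 0) by (rewrite length_map, length_seq; lia).
  rewrite map_nth, seq_nth; auto.
Qed.

Lemma prefix_eq_map_seq (s : list bool) (x : real) :
  prefix s x -> s = map x (seq 0 (length s)).
Proof.
  intros H. apply nth_ext with (d := false) (d' := false).
  - now rewrite length_map, length_seq.
  - intros i Hi. rewrite <- (H i Hi). apply prefix_map_seq.
    now rewrite length_map, length_seq.
Qed.

Lemma dense_on_mono (f : nat -> real) (A B : nat -> Prop) (s : list bool) :
  (forall k, A k -> B k) -> dense_on f A s -> dense_on f B s.
Proof.
  intros HAB H u. destruct (H u) as [k [Hk Hp]]. exists k. auto.
Qed.

(** Some basic set inside [s ++ u] contains no value on [B], while [A] still has a value there.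
    Since [s] stays the same, removals can be iterated. *)
Lemma dense_on_diff (f : nat -> real) (A B : nat -> Prop) (s : list bool) :
  dense_on f A s -> ~ somewhere_dense f B ->
  dense_on f (fun k => A k /\ ~ B k) s.
Proof.
  intros HA HB u.
  destruct (not_all_ex_not _ _ (fun h => HB (ex_intro _ (s ++ u) h))) as [v Hv].
  destruct (HA (u ++ v)) as [k [Hk Hp]]. rewrite app_assoc in Hp.
  exists k. split; [split; auto|].
  - intros Bk. apply Hv. eauto.
  - eapply prefix_app_l; eauto.
Qed.

Lemma finite_not_somewhere_dense (f : nat -> real) (N : nat) :
  ~ somewhere_dense f (fun k => k < N).
Proof.
  intros [s Hs].
  assert (H : exists u, forall k, k < N -> ~ prefix (s ++ u) (f k)).
  { clear Hs. induction N as [|N [u Hu]].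
    - exists nil. lia.
    - exists (u ++ negb (f N (length (s ++ u))) :: nil). intros k Hk Hp.
      rewrite app_assoc in Hp.
      destruct (Nat.eq_dec k N) as [->|].
      + specialize (Hp (length (s ++ u))
          ltac:(rewrite (length_app (s ++ u)); simpl; lia)).
        rewrite nth_middle in Hp. now destruct (f N (length (s ++ u))).
      + apply (Hu k); [lia|]. eapply prefix_app_l; eauto. }
  destruct H as [u Hu]. destruct (Hs u) as [k [Hk Hp]]. exact (Hu k Hk Hp).
Qed.

Lemma nowhere_dense_image (f : nat -> real) (A : nat -> Prop) :
  ~ somewhere_dense f A -> nowhere_dense (image f A).
Proof.
  intros H s.
  destruct (not_all_ex_not _ _ (fun h => H (ex_intro _ s h))) as [u Hu].
  exists (s ++ u). split; [|split].
  - intros i Hi. now apply app_nth1.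
  - rewrite length_app. lia.
  - intros x Hx [k [Ak <-]]. apply Hu. eauto.
Qed.

(** * One sequence for countably many filters *)

Definition free_filter (V : (nat -> Prop) -> Prop) : Prop :=
  ~ V (fun _ => False) /\
  (forall A B : nat -> Prop, V A -> (forall n, A n -> B n) -> V B) /\
  (forall A B : nat -> Prop, V A -> V B -> V (fun n => A n /\ B n)) /\
  (forall N, V (fun k => N <= k)).

Lemma free_filter_ultrafilter (V : (nat -> Prop) -> Prop) :
  free_filter V ->
  exists U : (nat -> Prop) -> Prop,
    ultrafilter U /\ ~ principal U /\ forall A, V A -> U A.
Proof.
  intros [V0 [VS [VI VN]]].
  assert (FV : filter.ProperFilter (T := nat) V).
  { constructor; [exact V0|]. constructor.
    - apply (VS _ _ (VN 0)). now intros.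
    - intros A B HA HB. exact (VI A B HA HB).
    - intros A B HAB HA. exact (VS A B HA HAB). }
  destruct (filter.ultraFilterLemma FV) as [U [UU VU]].
  pose proof (@filter.ultra_proper _ _ UU) as UP.
  destruct UP as [U0 [UT UI US]].
  exists U. split; [|split].
  - split; [exact UT|]. split; [exact U0|]. split; [|split].
    + intros A B HA HAB. exact (US A B HAB HA).
    + intros A B HA HB. exact (UI A B HA HB).
    + intros A. exact (filter.in_ultra_setVsetC A UU).
  - intros [k Hk]. apply (Nat.nle_succ_diag_l k).
    apply (Hk (fun i => S k <= i)). apply VU, VN.
  - exact VU.
Qed.

(** The first [n] bits split the indices into finitely many classes, and an ultrafilter contains one
    of them. *)
Lemma ultrafilter_word (U : (nat -> Prop) -> Prop) (f : nat -> real) (n : nat) :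
  ultrafilter U ->
  exists s, length s = n /\ U (fun k => prefix s (f k)).
Proof.
  intros [UT [U0 [US [UI UC]]]]. induction n as [|n [s [Hl Hs]]].
  - exists nil. split; [reflexivity|]. apply (US _ _ UT). intros k _ i Hi.
    simpl in Hi. lia.
  - assert (H : exists b, U (fun k => f k n = b)).
    { destruct (UC (fun k => f k n = true)) as [h|h]; [eauto|].
      exists false. apply (US _ _ h). intros k.
      destruct (f k n); congruence. }
    destruct H as [b Hb]. exists (s ++ b :: nil). split.
    { rewrite length_app. simpl. lia. }
    apply (US _ _ (UI _ _ Hs Hb)). intros k [h1 h2].
    apply prefix_app; [exact h1|]. intros i Hi. simpl in Hi.
    replace i with 0 by lia. rewrite Hl, Nat.add_0_r. exact h2.
Qed.

Section Fusion.

Hypothesis no_nowhere_dense :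
  forall U, ultrafilter U -> ~ principal U -> ~ nowhere_dense_filter U.

Lemma ultrafilter_somewhere_dense (U : (nat -> Prop) -> Prop) :
  ultrafilter U -> ~ principal U ->
  exists g, forall A, U A -> somewhere_dense g A.
Proof.
  intros HU HP. apply NNPP. intros H. apply (no_nowhere_dense U HU HP).
  intros f. apply NNPP. intros Hf. apply H. exists f. intros A HA.
  apply NNPP. intros HA'. apply Hf. exists A. split; [exact HA|].
  now apply nowhere_dense_image.
Qed.

(* The set [B] on which [f] is changed is negligible for every filter already handled, and
   keeping the first [n] bits makes the sequence of corrections converge. *)
Definition fusion_step (V : (nat -> Prop) -> Prop) (n : nat) (f f' : nat -> real) : Prop :=
  (forall k i, i < n -> f' k i = f k i) /\
  (exists B, ~ somewhere_dense f B /\ forall k, ~ B k -> f' k = f k) /\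
  (free_filter V -> forall A, V A -> somewhere_dense f' A).

Lemma fusion_step_exists (V : (nat -> Prop) -> Prop) (n : nat) (f : nat -> real) :
  exists f', fusion_step V n f f'.
Proof.
  destruct (classic (free_filter V -> forall A, V A -> somewhere_dense f A)) as [H|H].
  { exists f. split; [auto|]. split; [|exact H].
    exists (fun k => k < 0). split; [apply finite_not_somewhere_dense|auto]. }
  apply imply_to_and in H. destruct H as [HV H].
  apply not_all_ex_not in H. destruct H as [B HB].
  apply imply_to_and in HB. destruct HB as [VB HB].
  destruct (free_filter_ultrafilter V HV) as [U [HU [HP VU]]].
  destruct (ultrafilter_somewhere_dense U HU HP) as [g Hg].
  destruct (ultrafilter_word U f n HU) as [w [Hl Hw]].
  (* On [B], the first [n] bits of [f k] are followed by all of [g k]. Where [f k] begins with [w],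
     density of [g] in [s] becomes density of [f'] in [w ++ s]. *)
  pose (f' := fun k i =>
    if excluded_middle_informative (B k)
    then if lt_dec i n then f k i else g k (i - n)
    else f k i).
  exists f'. split; [|split].
  - intros k i Hi. unfold f'. destruct excluded_middle_informative; auto.
    destruct lt_dec; [auto|lia].
  - exists B. split; [exact HB|]. intros k Hk. unfold f'.
    destruct excluded_middle_informative; [contradiction|reflexivity].
  - intros _ A VA. destruct HU as [_ [_ [_ [UI _]]]].
    destruct (Hg _ (UI _ _ (UI _ _ (VU _ VA) (VU _ VB)) Hw)) as [s Hs].
    exists (w ++ s). intros u. destruct (Hs u) as [k [[[Ak Bk] wk] Hp]].
    exists k. split; [exact Ak|]. rewrite <- app_assoc.
    unfold f'. destruct excluded_middle_informative as [_|]; [|contradiction].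
    apply prefix_app.
    + intros i Hi. destruct lt_dec; [|lia]. now apply wk.
    + intros i Hi. destruct lt_dec; [lia|].
      rewrite <- (Hp i Hi). f_equal. lia.
Qed.

(** Stage [n] handles [V n]. Each later change is confined to a set where the current sequence is
    not somewhere dense, so density in the same [s] survives. *)
Lemma fusion (V : nat -> (nat -> Prop) -> Prop) :
  exists F : nat -> real,
    forall n, free_filter (V n) -> forall A, V n A -> somewhere_dense F A.
Proof.
  assert (Hc : exists step : nat * (nat -> real) -> nat -> real,
             forall x, fusion_step (V (fst x)) (fst x) (snd x) (step x)).
  { apply (choice (fun x f' => fusion_step (V (fst x)) (fst x) (snd x) f')).
    intros [n f]. apply fusion_step_exists. }
  destruct Hc as [step Hstep].
  pose (f := nat_rect (fun _ => nat -> real) (fun _ _ => false)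
               (fun n g => step (n, g))).
  assert (Hf : forall n, fusion_step (V n) n (f n) (f (S n)))
    by (intros n; exact (Hstep (n, f n))).
  clearbody f. clear Hstep step.
  assert (Hstable : forall k i m, i < m -> f m k i = f (S i) k i).
  { intros k i m Hm. induction Hm as [|m Hm IH]; [reflexivity|].
    rewrite (proj1 (Hf m)); [exact IH|lia]. }
  (* Bit [i] can still change at step [i], and is final in [f (S i)]. *)
  exists (fun k i => f (S i) k i). intros n HV A VA.
  destruct (proj2 (proj2 (Hf n)) HV A VA) as [s Hs]. exists s.
  assert (Hall : forall m, S n <= m -> dense_on (f m) A s).
  { intros m Hm. induction Hm as [|m Hm IH]; [exact Hs|].
    destruct (Hf m) as [_ [[B [HB HfB]] _]]. intros u.
    destruct (dense_on_diff _ _ _ _ IH HB u) as [k [[Ak Bk] Hp]].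
    exists k. split; [exact Ak|]. now rewrite HfB. }
  (* Late enough for [Hall] to apply and for [f m] to agree with the limit on the bits of
     [s ++ u]. *)
  intros u. pose (m := S n + length (s ++ u)).
  destruct (Hall m ltac:(lia) u) as [k [Ak Hp]]. exists k. split; [exact Ak|].
  intros i Hi. rewrite <- (Hp i Hi). symmetry. apply Hstable. lia.
Qed.

End Fusion.

(** * Splitting open sets of conditions *)

Section Forcing.

Context (P : forcing).

(** For upward closed [C]: [p] does not force the generic filter to miss [C]. *)
Definition meets (C : P -> Prop) (p : P) : Prop := exists r, le P p r /\ C r.

Definition upward_closed (C : P -> Prop) : Prop :=
  forall p q, le P p q -> C p -> C q.

Lemma meets_le (C : P -> Prop) (p q : P) : le P p q -> meets C q -> meets C p.
Proof.
  intros H [r [Hr Cr]]. exists r. split; [|exact Cr]. eapply le_trans; eauto.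
Qed.

(** Directedness combines [p] with members of [A] avoiding the first [N] pieces into one [q] in [A].
    A piece met by [q] has index at least [N] and is met by [p]. *)
Lemma directed_meets_infinitely (A : P -> Prop) (C : nat -> P -> Prop) :
  directed P A ->
  (forall p, A p -> exists k, meets (C k) p) ->
  (forall k, exists p, A p /\ ~ meets (C k) p) ->
  forall p N, A p -> exists k, N <= k /\ meets (C k) p.
Proof.
  intros HA Hmeet Havoid p N Ap.
  assert (H : exists q, A q /\ le P p q /\ forall k, k < N -> ~ meets (C k) q).
  { induction N as [|N [q [Aq [Hq Hk]]]].
    - exists p. split; [exact Ap|]. split; [apply le_refl|lia].
    - destruct (Havoid N) as [q' [Aq' Hq']].
      destruct (HA q q' Aq Aq') as [r [Ar [H1 H2]]].
      exists r. split; [exact Ar|]. split; [eapply le_trans; eauto|].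
      intros k Hlt Hr. destruct (Nat.eq_dec k N) as [->|].
      + apply Hq'. eapply meets_le; eauto.
      + apply (Hk k); [lia|]. eapply meets_le; eauto. }
  destruct H as [q [Aq [Hq Hk]]]. destruct (Hmeet q Aq) as [k Hm].
  exists k. split; [|eapply meets_le; eauto].
  destruct (le_lt_dec N k) as [|h]; [assumption|]. destruct (Hk k h Hm).
Qed.

Lemma infinite_antichain_above (c : P) :
  splitting P ->
  exists d : nat -> P,
    (forall i, le P c (d i)) /\
    forall i j q, le P (d i) q -> le P (d j) q -> i = j.
Proof.
  intros Hsplit.
  destruct (choice (fun p (x : P * P) => le P p (fst x) /\ le P p (snd x)
                                         /\ ~ compatible P (fst x) (snd x)))
    as [f Hf].
  { intros p. destruct (Hsplit p) as [q1 [q2 H]]. now exists (q1, q2). }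
  (* A comb: the chain [e] follows the second halves of the incompatible pairs, and the first halves
     branching off form the antichain. *)
  pose (e := nat_rect (fun _ => P : Type) c (fun _ x => snd (f x))).
  assert (He : forall i j, i <= j -> le P (e i) (e j)).
  { intros i j H. induction H; [apply le_refl|].
    eapply le_trans; [exact IHle|]. apply (Hf (e m)). }
  assert (Hd : forall i, le P (e i) (fst (f (e i)))) by (intros; apply Hf).
  assert (Hlt : forall i j q, i < j -> le P (fst (f (e i))) q ->
                le P (fst (f (e j))) q -> False).
  { intros i j q Hij Hi Hj. apply (proj2 (proj2 (Hf (e i)))).
    exists q. split; [exact Hi|]. eapply le_trans; [|exact Hj].
    eapply le_trans; [|apply Hd]. exact (He (S i) j Hij). }
  exists (fun i => fst (f (e i))). split.
  - intros i. eapply le_trans; [|apply Hd]. apply (He 0 i). lia.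
  - intros i j q Hi Hj. destruct (Nat.lt_total i j) as [h|[h|h]]; [|exact h|].
    + destruct (Hlt i j q h Hi Hj).
    + destruct (Hlt j i q h Hj Hi).
Qed.

(** Pieces may be empty. The last clause is conditional because a [p] that misses [S] misses every
    piece. *)
Definition is_split (A S : P -> Prop) (C : nat -> P -> Prop) : Prop :=
  (forall k, upward_closed (C k)) /\
  (forall k q, C k q -> S q) /\
  (forall j k q, C j q -> C k q -> j = k) /\
  (forall q, S q -> exists k, meets (C k) q) /\
  ((forall p, A p -> meets S p) ->
   forall p N, A p -> exists k, N <= k /\ meets (C k) p).

(* If some [c] in [S] has only extensions compatible with all of [A], an infinite antichain
   above [c] gives the pieces. Otherwise densely many conditions in [S] are incompatible with
   a member of [A]; pick such a condition in each centered piece and make the cones disjoint. *)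
Lemma split_exists (A S : P -> Prop) :
  sigma_centered P -> splitting P -> directed P A -> upward_closed S ->
  exists C, is_split A S C.
Proof.
  intros [B [Bcover Bdir]] Hsplit HA HS.
  destruct (classic (exists c, S c /\ forall c' p, le P c c' -> A p -> compatible P p c'))
    as [[c [Sc Hc]]|Hno].
  - destruct (infinite_antichain_above c Hsplit) as [d [Hcd Hd]].
    (* Piece 0 collects what is incompatible with the whole antichain, making the union dense in
       [S]. *)
    exists (fun k q => S q /\ match k with
                    | 0 => forall i, ~ compatible P (d i) q
                    | Datatypes.S i => le P (d i) q
                    end).
    split; [|split; [|split; [|split]]].
    + intros [|i] p q Hpq [Sp Hp]; (split; [exact (HS p q Hpq Sp)|]).
      * intros i [r [H1 H2]]. apply (Hp i). exists r. split; [exact H1|].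
        eapply le_trans; eauto.
      * eapply le_trans; eauto.
    + intros k q [Sq _]. exact Sq.
    + intros [|i] [|j] q [_ Hi] [_ Hj].
      * reflexivity.
      * destruct (Hi j). exists q. split; [exact Hj|apply le_refl].
      * destruct (Hj i). exists q. split; [exact Hi|apply le_refl].
      * f_equal. eapply Hd; eauto.
    + intros q Sq. destruct (classic (exists i, compatible P (d i) q)) as [[i [r [H1 H2]]]|H].
      * exists (Datatypes.S i). exists r. split; [exact H2|]. split; [|exact H1].
        exact (HS q r H2 Sq).
      * exists 0, q. split; [apply le_refl|]. split; [exact Sq|].
        intros i Hi. apply H. eauto.
    + intros _ p N Ap. exists (Datatypes.S N). split; [lia|].
      destruct (Hc (d N) p (Hcd N) Ap) as [r [H1 H2]].
      exists r. split; [exact H1|]. split; [|exact H2].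
      eapply HS; [|exact Sc]. eapply le_trans; [apply Hcd|exact H2].
  - pose (E := fun q => S q /\ exists p, A p /\ ~ compatible P p q).
    assert (HE : forall q, S q -> meets E q).
    { intros q Sq. apply NNPP. intros Hq. apply Hno. exists q. split; [exact Sq|].
      intros c' p Hc' Ap. apply NNPP. intros Hp. apply Hq.
      exists c'. split; [exact Hc'|]. split; [exact (HS q c' Hc' Sq)|eauto]. }
    destruct (choice (fun m (o : option P) =>
      match o with Some x => B m x /\ E x | None => forall x, B m x -> ~ E x end))
      as [e He].
    { intros m. destruct (classic (exists x, B m x /\ E x)) as [[x Hx]|H].
      - now exists (Some x).
      - exists None. intros x Bx Ex. apply H. eauto. }
    pose (above := fun m q => match e m with Some x => le P x q | None => False end).
    assert (Habove : forall m, upward_closed (above m)).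
    { intros m p q Hpq. unfold above. destruct (e m); [|auto].
      intros H. eapply le_trans; eauto. }
    pose (C := fun m q => above m q /\ forall j, j < m -> ~ meets (above j) q).
    assert (CS : forall m q, C m q -> S q).
    { intros m q [Hm _]. unfold above in Hm. specialize (He m).
      destruct (e m) as [x|]; [|contradiction].
      destruct He as [_ [Sx _]]. exact (HS x q Hm Sx). }
    assert (Cdense : forall q, S q -> exists k, meets (C k) q).
    { intros q Sq. destruct (HE q Sq) as [q' [Hqq' Eq']].
      destruct (Bcover q') as [m Bm].
      (* [q'] is compatible with the condition chosen from its own directed piece [B m]. For the
         least cone that [q'] meets, extensions of [q'] miss all earlier cones. *)
      assert (Hm : meets (above m) q').
      { specialize (He m). unfold above. destruct (e m) as [x|].
        - destruct (Bdir m q' x Bm (proj1 He)) as [r [_ [H1 H2]]].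
          now exists r.
        - destruct (He q' Bm Eq'). }
      clear Bm. induction m as [m IH] using (well_founded_induction lt_wf).
      destruct (classic (exists j, j < m /\ meets (above j) q')) as [[j [Hj Hjm]]|H].
      - exact (IH j Hj Hjm).
      - exists m. destruct Hm as [r [Hr Hr']].
        exists r. split; [eapply le_trans; eauto|]. split; [exact Hr'|].
        intros j Hj Hjr. apply H. exists j. split; [exact Hj|].
        eapply meets_le; eauto. }
    exists C. split; [|split; [|split; [|split]]].
    + intros m p q Hpq [H1 H2]. split; [exact (Habove m p q Hpq H1)|].
      intros j Hj Hq. apply (H2 j Hj). eapply meets_le; eauto.
    + exact CS.
    + assert (Hlt : forall j k q, j < k -> C j q -> C k q -> False).
      { intros j k q Hjk [Hj _] [_ Hk]. apply (Hk j Hjk).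
        exists q. split; [apply le_refl|exact Hj]. }
      intros j k q Hj Hk. destruct (Nat.lt_total j k) as [h|[h|h]]; [|exact h|].
      * destruct (Hlt j k q h Hj Hk).
      * destruct (Hlt k j q h Hk Hj).
    + exact Cdense.
    + intros Hmeet p N Ap. apply (directed_meets_infinitely A C HA); [| |exact Ap].
      * intros p' Ap'. destruct (Hmeet p' Ap') as [r [Hr Sr]].
        destruct (Cdense r Sr) as [k Hk]. exists k. eapply meets_le; eauto.
      (* Members of [C k] extend the chosen [x], so the member of [A] incompatible with [x] misses
         [C k]. *)
      * intros k. specialize (He k). unfold C, above.
        destruct (e k) as [x|].
        -- destruct He as [_ [_ [p' [Ap' Hp']]]]. exists p'. split; [exact Ap'|].
           intros [r [Hr [Hx _]]]. apply Hp'. exists r. auto.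
        -- exists p. split; [exact Ap|]. intros [r [_ [[] _]]].
Qed.

(** * The tree and its labels *)

(* A node is listed from its last child index back to the root. *)
Fixpoint node (C : nat -> (P -> Prop) -> nat -> P -> Prop) (v : list nat) : P -> Prop :=
  match v with
  | nil => fun _ => True
  | k :: w => C (length w) (node C w) k
  end.

(** Taking [S k] bits makes labels grow at every level and lets children of large index show long
    prefixes of [f w k]. *)
Fixpoint label (f : list nat -> nat -> real) (v : list nat) : list bool :=
  match v with
  | nil => nil
  | k :: w => label f w ++ map (f w k) (seq 0 (S k))
  end.

Lemma label_app (f : list nat -> nat -> real) (l v : list nat) :
  exists u, label f (l ++ v) = label f v ++ u.
Proof.
  induction l as [|k l [u Hu]]; simpl.
  - exists nil. now rewrite app_nil_r.
  - rewrite Hu, <- app_assoc. eauto.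
Qed.

Lemma length_label (f : list nat -> nat -> real) (v : list nat) :
  length v <= length (label f v).
Proof.
  induction v as [|k v IH]; [simpl; lia|].
  cbn [label length]. rewrite length_app, length_map, length_seq. lia.
Qed.

Section Tree.

Context (A : nat -> P -> Prop) (C : nat -> (P -> Prop) -> nat -> P -> Prop).

Hypothesis A_directed : forall n, directed P (A n).

Hypothesis C_split : forall n S, upward_closed S -> is_split (A n) S (C n S).

Lemma node_upward_closed (v : list nat) : upward_closed (node C v).
Proof.
  induction v as [|k v IH]; [intros p q _ _; exact I|].
  exact (proj1 (C_split (length v) _ IH) k).
Qed.

Lemma node_is_split (v : list nat) :
  is_split (A (length v)) (node C v) (fun k => node C (k :: v)).
Proof. exact (C_split (length v) _ (node_upward_closed v)). Qed.

Lemma node_suffix (l v : list nat) (q : P) : node C (l ++ v) q -> node C v q.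
Proof.
  induction l as [|k l IH]; [auto|]. intros H. apply IH.
  exact (proj1 (proj2 (node_is_split (l ++ v))) k q H).
Qed.

Lemma node_comparable (v w : list nat) (q : P) :
  node C v q -> node C w q -> exists l, v = l ++ w \/ w = l ++ v.
Proof.
  intros Hv Hw. induction v as [|k v IH].
  - exists w. right. now rewrite app_nil_r.
  - destruct (IH (node_suffix (k :: nil) v q Hv)) as [l [->| ->]].
    + exists (k :: l). now left.
    (* The root is at the end of the list, so the last entry [j] of [l] is the child of [v] through
       which [w] passes; disjointness of siblings gives [j = k]. *)
    + destruct l as [|j l _] using rev_ind.
      * exists (k :: nil). now left.
      * rewrite <- app_assoc in Hw. simpl in Hw.
        apply node_suffix in Hw. exists l. right.
        rewrite <- app_assoc. simpl. f_equal. f_equal.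
        exact (proj1 (proj2 (proj2 (node_is_split v))) j k q Hw Hv).
Qed.

Lemma node_level (p : P) (m : nat) :
  exists v, length v = m /\ meets (node C v) p.
Proof.
  induction m as [|m [v [Hv [r [Hr Hn]]]]].
  - exists nil. split; [reflexivity|]. exists p. split; [apply le_refl|exact I].
  - destruct (proj1 (proj2 (proj2 (proj2 (node_is_split v)))) r Hn) as [k Hk].
    exists (k :: v). split; [simpl; now f_equal|]. eapply meets_le; eauto.
Qed.

(* If no such node existed, some node of each level would meet all of [A n], and at
   level [n] the splitting was chosen to rule this out. *)
Lemma node_meets_infinitely (n : nat) :
  exists v, forall p N, A n p -> exists k, N <= k /\ meets (node C (k :: v)) p.
Proof.
  apply NNPP. intros Hno.
  assert (H : forall m, exists v, length v = m /\ forall p, A n p -> meets (node C v) p).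
  { induction m as [|m [v [Hv Hmeet]]].
    - exists nil. split; [reflexivity|]. intros p _. exists p.
      split; [apply le_refl|exact I].
    - destruct (classic (exists k, forall p, A n p -> meets (node C (k :: v)) p))
        as [[k Hk]|Hk].
      + exists (k :: v). split; [simpl; now f_equal|exact Hk].
      + destruct Hno. exists v.
        apply (directed_meets_infinitely (A n) (fun k => node C (k :: v)) (A_directed n)).
        * intros p Ap. destruct (Hmeet p Ap) as [r [Hr Hn]].
          destruct (proj1 (proj2 (proj2 (proj2 (node_is_split v)))) r Hn) as [k Hkr].
          exists k. eapply meets_le; eauto.
        * intros k. apply NNPP. intros H. apply Hk. exists k. intros p Ap.
          apply NNPP. intros H'. apply H. eauto. }
  destruct (H n) as [v [Hv Hmeet]]. apply Hno. exists v.
  pose proof (node_is_split v) as Hs. rewrite Hv in Hs.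
  exact (proj2 (proj2 (proj2 (proj2 Hs))) Hmeet).
Qed.

(** Generated by the cofinite sets and the sets of children of [v] met by the members of [A n]. *)
Definition trace_filter (n : nat) (v : list nat) (X : nat -> Prop) : Prop :=
  exists p N, A n p /\ forall k, N <= k -> meets (node C (k :: v)) p -> X k.

Lemma trace_filter_free (n : nat) (v : list nat) :
  (exists p, A n p) ->
  (forall p N, A n p -> exists k, N <= k /\ meets (node C (k :: v)) p) ->
  free_filter (trace_filter n v).
Proof.
  intros [p Ap] Hinf. split; [|split; [|split]].
  - intros [q [N [Aq H]]]. destruct (Hinf q N Aq) as [k [Hk Hm]]. eauto.
  - intros X Y [q [N [Aq H]]] HXY. exists q, N. split; [exact Aq|]. auto.
  - intros X Y [q [N [Aq H]]] [q' [N' [Aq' H']]].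
    destruct (A_directed n q q' Aq Aq') as [r [Ar [Hr Hr']]].
    exists r, (N + N'). split; [exact Ar|]. intros k Hk Hm. split.
    + apply H; [lia|]. eapply meets_le; eauto.
    + apply H'; [lia|]. eapply meets_le; eauto.
  - intros N. exists p, N. auto.
Qed.

(** * The name for the union of the labels along the generic branch *)

Context (f : list nat -> nat -> real).

Definition decides (q : P) (i : nat) (b : bool) : Prop :=
  exists v, node C v q /\ i < length (label f v) /\ nth i (label f v) false = b.

Lemma decides_le (p q : P) (i : nat) (b : bool) :
  le P p q -> decides p i b -> decides q i b.
Proof.
  intros H [v [Hv Hb]]. exists v. split; [|exact Hb].
  exact (node_upward_closed v p q H Hv).
Qed.

Lemma decides_unique (q : P) (i : nat) (b b' : bool) :
  decides q i b -> decides q i b' -> b = b'.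
Proof.
  intros [v [Hv [Hi <-]]] [w [Hw [Hj <-]]].
  destruct (node_comparable v w q Hv Hw) as [l [->| ->]].
  - destruct (label_app f l w) as [u ->]. now rewrite app_nth1.
  - destruct (label_app f l v) as [u ->]. now rewrite app_nth1.
Qed.

Lemma branch_name_exists :
  exists r : real_name P, forall p i b, decides p i b -> forces P r p i b.
Proof.
  (* [decides] need not be closed under dense decision, so forcing is defined as being decided
     densely above [p]. *)
  unshelve eexists (Build_real_name P
    (fun p i b => forall q, le P p q -> exists r, le P q r /\ decides r i b) _ _ _ _).
  - intros p q i b Hpq H r Hr. apply H. eapply le_trans; eauto.
  - intros p i [H1 H2]. destruct (H1 p (le_refl P p)) as [q [Hq D1]].
    destruct (H2 q Hq) as [r [Hr D2]].
    discriminate (decides_unique r i true false (decides_le q r i true Hr D1) D2).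
  - intros p i. destruct (node_level p (S i)) as [v [Hv [q [Hq Hn]]]].
    exists q, (nth i (label f v) false). split; [exact Hq|].
    intros q' Hq'. exists q'. split; [apply le_refl|].
    exists v. split; [exact (node_upward_closed v q q' Hq' Hn)|].
    split; [|reflexivity]. pose proof (length_label f v). lia.
  - intros p i b H q Hq. destruct (H q Hq) as [r [Hr Hr']].
    destruct (Hr' r (le_refl P r)) as [r' [Hr1 Hr2]].
    exists r'. split; [eapply le_trans; eauto|exact Hr2].
  - intros p i b H q Hq. exists q. split; [apply le_refl|].
    eapply decides_le; eauto.
Qed.

Hypothesis A_cover : forall p, exists n, A n p.

Hypothesis f_somewhere_dense : forall v n, free_filter (trace_filter n v) ->
  forall X, trace_filter n v X -> somewhere_dense (f v) X.

Lemma branch_name_cohen : adds_cohen_real P.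
Proof.
  destruct branch_name_exists as [r Hr]. exists r. intros D Dopen Ddense p.
  destruct (A_cover p) as [n Ap]. destruct (node_meets_infinitely n) as [v Hinf].
  pose (X := fun k => meets (node C (k :: v)) p).
  destruct (f_somewhere_dense v n (trace_filter_free n v (ex_intro _ p Ap) Hinf) X)
    as [s Hs].
  { exists p, 0. auto. }
  destruct (Ddense (label f v ++ s)) as [x [Hx Dx]].
  destruct (Dopen x Dx) as [n0 Hn0].
  (* Long enough for the prefix of [x] to extend [label f v ++ s] and to put its basic set inside
     [D]. *)
  pose (len := length (label f v ++ s) + n0).
  assert (Hu : exists u, map x (seq 0 len) = (label f v ++ s) ++ u).
  { unfold len. rewrite seq_app, map_app.
    rewrite <- (prefix_eq_map_seq _ _ Hx). eauto. }
  destruct Hu as [u Hu]. rewrite <- app_assoc in Hu.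
  (* Discarding small [k] ensures that the [S k] bits contributed by child [k] cover all of
     [s ++ u]. *)
  pose proof (dense_on_diff _ _ _ _ Hs
                (finite_not_somewhere_dense (f v) (length (s ++ u)))) as Hs'.
  destruct (Hs' u) as [k [[[q [Hpq Hq]] Hk] Hp]].
  exists q, (map x (seq 0 len)). split; [exact Hpq|]. split.
  - intros y Hy. apply Hn0. intros i Hi. rewrite Hy, prefix_map_seq; trivial;
      rewrite length_map, length_seq; unfold len; lia.
  - assert (Hlab : exists w, label f (k :: v) = map x (seq 0 len) ++ w).
    { cbn [label]. rewrite Hu, (prefix_eq_map_seq _ _ Hp).
      replace (S k) with (length (s ++ u) + (S k - length (s ++ u))) by lia.
      rewrite seq_app, map_app, app_assoc. eauto. }
    destruct Hlab as [w Hw]. intros i Hi. apply Hr.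
    exists (k :: v). split; [exact Hq|]. rewrite Hw. split.
    + rewrite length_app. lia.
    + now rewrite app_nth1.
Qed.

End Tree.

End Forcing.

Theorem theorem2 (P : forcing) :
  sigma_centered P -> splitting P -> ~ adds_cohen_real P ->
  exists U : (nat -> Prop) -> Prop,
    ultrafilter U /\ ~ principal U /\ nowhere_dense_filter U.
Proof.
  intros Hcentered Hsplit Hcohen. apply NNPP. intros Hno. apply Hcohen.
  assert (no_nwd : forall U, ultrafilter U -> ~ principal U -> ~ nowhere_dense_filter U).
  { intros U H1 H2 H3. apply Hno. eauto. }
  pose proof Hcentered as [A [Acover Adir]].
  destruct (choice (fun (x : nat * (P -> Prop)) C =>
    upward_closed P (snd x) -> is_split P (A (fst x)) (snd x) C)) as [C HC].
  { intros [n S]. destruct (classic (upward_closed P S)) as [HS|HS].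
    - destruct (split_exists P (A n) S Hcentered Hsplit (Adir n) HS) as [C HC]. eauto.
    - exists (fun _ => S). contradiction. }
  pose (C' := fun n S => C (n, S)).
  (* The node that serves [A n] is not known in advance, so each [f v] handles all [n] at once. *)
  destruct (choice (fun v g => forall n, free_filter (trace_filter P A C' n v) ->
    forall X, trace_filter P A C' n v X -> somewhere_dense g X)) as [f Hf].
  { intros v. exact (fusion no_nwd (fun n => trace_filter P A C' n v)). }
  apply (branch_name_cohen P A C') with (f := f); auto.
  intros n S. exact (HC (n, S)).
Qed.
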